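(* The equation $(x^4+y^4)(a^2+b^2)=z^4+w^4$, where $(a,b)=\left(\frac{m^2-n^2}{2},\frac{m^2+n^2}{2}\right)$ and $m,n$ are arbitrary integers of the same parity, has infinitely many parametric solutions. That is, there exist infinitely many pairwise non-proportional quadruples $(x,y,z,w)\neq(0,0,0,0)$ of polynomials in $\mathbb{Z}[m,n]$ such that, for all integers $m,n$ of the same parity, with $a=\frac{m^2-n^2}{2}$ and $b=\frac{m^2+n^2}{2}$, $$\bigl(x(m,n)^4+y(m,n)^4\bigr)(a^2+b^2)=z(m,n)^4+w(m,n)^4 .$$
   Context: A parametric solution of the equation is a quadruple $(x,y,z,w)$ of polynomials with integer coefficients in the parameters $m,n$, not all zero, satisfying the equation identically in the parameters. Two quadruples $(x,y,z,w)$ and $(x',y',z',w')$ are proportional if there is a nonzero $\lambda\in\mathbb{Q}(m,n)$ with $(x',y',z',w')=(\lambda x,\lambda y,\lambda z,\lambda w)$; proportional quadruples are counted as the same solution. *)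

(* Defs.v *)
From mathcomp Require Import all_boot all_order all_algebra.
From mathcomp Require Import mpoly.

Set Implicit Arguments.
Unset Strict Implicit.
Unset Printing Implicit Defensive.

Import Order.TTheory GRing.Theory Num.Theory.
Local Open Scope ring_scope.

(* Z[m,n], with 'X_0 standing for m and 'X_1 for n. *)
Definition Zmn := {mpoly int[2]}.
Definition Qmn := {fraction {mpoly rat[2]}}.

Definition quadruple : Type := Zmn * Zmn * Zmn * Zmn.

Definition evalmn (m n : int) (p : Zmn) : int := p.@[tnth [tuple m; n]].

Definition toQmn (p : Zmn) : Qmn :=
  tofrac (map_mpoly (intr : int -> rat) p).

(* The coefficients a and b are taken in rat so that the division by 2 is the
   true one; for m and n of the same parity they are integers. *)
Definition coef_a (m n : int) : rat := (m%:Q ^+ 2 - n%:Q ^+ 2) / 2.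
Definition coef_b (m n : int) : rat := (m%:Q ^+ 2 + n%:Q ^+ 2) / 2.

Definition parametric_solution (q : quadruple) : Prop :=
  let: (x, y, z, w) := q in
  (x, y, z, w) <> (0, 0, 0, 0) /\
  forall m n : int, (m = n %[mod 2])%Z ->
    let a := coef_a m n in
    let b := coef_b m n in
    ((evalmn m n x)%:Q ^+ 4 + (evalmn m n y)%:Q ^+ 4) * (a ^+ 2 + b ^+ 2) =
    (evalmn m n z)%:Q ^+ 4 + (evalmn m n w)%:Q ^+ 4.

Definition proportional (q q' : quadruple) : Prop :=
  let: (x, y, z, w) := q in
  let: (x', y', z', w') := q' in
  exists lambda : Qmn, lambda <> 0 /\
    (toQmn x', toQmn y', toQmn z', toQmn w') =
    (lambda * toQmn x, lambda * toQmn y, lambda * toQmn z, lambda * toQmn w).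

(* Main.v *)
(** The equation follows from the two quadrics a x^2 + b y^2 = z^2 and
    b x^2 - a y^2 = w^2, whose intersection is an elliptic curve over Q(m, n)
    with the point (1, 1, m, n). A secant-tangent construction starting from
    (1, 1, m, -n) produces a sequence of points on it. At m = 1 these are
    congruent to K (1, 1, 1, c n) modulo n, with the last coordinate correct
    modulo n^2, where K is a nonzero integer and c = 1 - 2^(k+1) for the k-th
    point; the values of c are distinct, so no two points are proportional. *)

Require Import Defs.
From mathcomp Require Import all_boot all_order all_algebra.
From mathcomp Require Import mpoly.
From mathcomp Require Import ring lra.

Set Implicit Arguments.
Unset Strict Implicit.
Unset Printing Implicit Defensive.

Import Order.TTheory GRing.Theory Num.Theory.
Local Open Scope ring_scope.

(** * Residual points on an intersection of two diagonal quadrics *)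

Definition diag_form (R : comNzRingType) (f u v : R * R * R * R) : R :=
  let: (f0, f1, f2, f3) := f in
  let: (u0, u1, u2, u3) := u in
  let: (v0, v1, v2, v3) := v in
  f0 * u0 * v0 + f1 * u1 * v1 + f2 * u2 * v2 + f3 * u3 * v3.

Definition comb3 (R : comNzRingType) (r s t : R) (u v w : R * R * R * R) :
    R * R * R * R :=
  let: (u0, u1, u2, u3) := u in
  let: (v0, v1, v2, v3) := v in
  let: (w0, w1, w2, w3) := w in
  (r * u0 + s * v0 + t * w0, r * u1 + s * v1 + t * w1,
   r * u2 + s * v2 + t * w2, r * u3 + s * v3 + t * w3).

(* The fourth intersection point of the curve f = g = 0 with the plane spanned
   by o and the tangent line at p, t being a tangent vector at p: eliminating
   the coefficient of p from the two equations f = g = 0 on p, t, o leaves a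
   linear equation, because f and g vanish at p and at o. *)
Definition residual (R : comNzRingType) (f g p t o : R * R * R * R) :
    R * R * R * R :=
  let bf := diag_form f p o in let bg := diag_form g p o in
  let cf := diag_form f t o in let cg := diag_form g t o in
  let qf := diag_form f t t in let qg := diag_form g t t in
  let N := cf * bg - cg * bf in
  let M := qf * bg - qg * bf in
  let L := cg * qf - cf * qg in
  comb3 (2%:R * N * L) (- (2%:R * N * M)) (M ^+ 2) p t o.

Lemma diag_form_comb3 (R : comNzRingType) (f p t o : R * R * R * R) (r s k : R) :
  diag_form f (comb3 r s k p t o) (comb3 r s k p t o) =
  r ^+ 2 * diag_form f p p + s ^+ 2 * diag_form f t t + k ^+ 2 * diag_form f o o
  + 2%:R * (r * s * diag_form f p t + r * k * diag_form f p o
            + s * k * diag_form f t o).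
Proof.
case: f p t o => [[[f0 f1] f2] f3] [[[p0 p1] p2] p3] [[[t0 t1] t2] t3].
by case=> [[[o0 o1] o2] o3]; rewrite /diag_form /comb3; ring.
Qed.

(** At this point [f] takes the value [4 N M^2 (L bf - M cf + N qf)], and similarly for [g]. Both
    vanish because [(L, -M, N)] is, up to sign, the cross product of [(bf, cf, qf)] and
    [(bg, cg, qg)]. *)
Lemma residual_on_curve (R : comNzRingType) (f g p t o : R * R * R * R) :
  diag_form f p p = 0 -> diag_form f p t = 0 -> diag_form f o o = 0 ->
  diag_form g p p = 0 -> diag_form g p t = 0 -> diag_form g o o = 0 ->
  diag_form f (residual f g p t o) (residual f g p t o) = 0 /\
  diag_form g (residual f g p t o) (residual f g p t o) = 0.
Proof.
move=> fpp fpt foo gpp gpt goo.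
by rewrite /residual; split; rewrite diag_form_comb3 ?fpp ?fpt ?foo ?gpp ?gpt ?goo;
  ring.
Qed.

(** * The curve and its sequence of points *)

(* The curve f = g = 0 is A x^2 + B y^2 = 2 z^2, B x^2 - A y^2 = 2 w^2 with
   A = 2a and B = 2b, on which (x^4 + y^4)(a^2 + b^2) = z^4 + w^4. *)
Definition form1 (R : comNzRingType) (m n : R) : R * R * R * R :=
  (m ^+ 2 - n ^+ 2, m ^+ 2 + n ^+ 2, - 2%:R, 0).
Definition form2 (R : comNzRingType) (m n : R) : R * R * R * R :=
  (m ^+ 2 + n ^+ 2, - (m ^+ 2 - n ^+ 2), 0, - 2%:R).

Definition on_curve (R : comNzRingType) (m n : R) (p : R * R * R * R) : Prop :=
  diag_form (form1 m n) p p = 0 /\ diag_form (form2 m n) p p = 0.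

(** Changing the sign of [x] preserves the curve. For m = 1 it also makes the reductions modulo n of
    the tangency point and of [(1, 1, m, n)] distinct, which keeps [M] nonzero there. *)
Definition next_point (R : comNzRingType) (m n : R) (p : R * R * R * R) :
    R * R * R * R :=
  let: (x, y, z, w) := p in
  residual (form1 m n) (form2 m n) (- x, y, z, w)
    (2%:R * z * w, 0, - ((m ^+ 2 - n ^+ 2) * x * w), - ((m ^+ 2 + n ^+ 2) * x * z))
    (1, 1, m, n).

Fixpoint point_seq (R : comNzRingType) (m n : R) (k : nat) : R * R * R * R :=
  if k is k'.+1 then next_point m n (point_seq m n k') else (1, 1, m, - n).

Lemma on_curve_point_seq (R : comNzRingType) (m n : R) (k : nat) :
  on_curve m n (point_seq m n k).
Proof.
elim: k => [|k]; first by rewrite /on_curve /=; split; ring.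
rewrite [point_seq m n k.+1]/=; case: (point_seq m n k) => [[[x y] z] w] [Hf Hg].
rewrite /= in Hf Hg.
rewrite /on_curve /next_point.
apply: (residual_on_curve (f := form1 m n) (g := form2 m n)); rewrite /diag_form /=.
- by rewrite -[RHS]Hf; ring.
- by ring.
- by ring.
- by rewrite -[RHS]Hg; ring.
- by ring.
- by ring.
Qed.

(** * Compatibility with ring morphisms *)

Definition map4 (R S : Type) (h : R -> S) (p : R * R * R * R) : S * S * S * S :=
  let: (x, y, z, w) := p in (h x, h y, h z, h w).

Lemma rmorph_diag_form (R S : comNzRingType) (h : {rmorphism R -> S}) f u v :
  h (diag_form f u v) = diag_form (map4 h f) (map4 h u) (map4 h v).
Proof.
case: f u v => [[[f0 f1] f2] f3] [[[u0 u1] u2] u3] [[[v0 v1] v2] v3].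
by rewrite /diag_form /map4 !rmorphD !rmorphM.
Qed.

Lemma rmorph_comb3 (R S : comNzRingType) (h : {rmorphism R -> S}) r s k u v w :
  map4 h (comb3 r s k u v w) = comb3 (h r) (h s) (h k) (map4 h u) (map4 h v) (map4 h w).
Proof.
case: u v w => [[[u0 u1] u2] u3] [[[v0 v1] v2] v3] [[[w0 w1] w2] w3].
by rewrite /comb3 /map4 !rmorphD !rmorphM.
Qed.

Lemma rmorph_residual (R S : comNzRingType) (h : {rmorphism R -> S}) f g p t o :
  map4 h (residual f g p t o) =
  residual (map4 h f) (map4 h g) (map4 h p) (map4 h t) (map4 h o).
Proof.
rewrite /residual rmorph_comb3 rmorphN rmorphXn !rmorphM !rmorphB !rmorphM.
by rewrite !rmorph_diag_form rmorph_nat.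
Qed.

Lemma rmorph_next_point (R S : comNzRingType) (h : {rmorphism R -> S}) (m n : R) p :
  map4 h (next_point m n p) = next_point (h m) (h n) (map4 h p).
Proof.
case: p => [[[x y] z] w]; rewrite /next_point rmorph_residual.
rewrite /form1 /form2 /map4.
by rewrite !(rmorphD, rmorphB, rmorphN, rmorphXn, rmorphM, rmorph1, rmorph0, rmorph_nat).
Qed.

Lemma rmorph_point_seq (R S : comNzRingType) (h : {rmorphism R -> S}) (m n : R) k :
  map4 h (point_seq m n k) = point_seq (h m) (h n) k.
Proof.
elim: k => [|k IH]; first by rewrite /= rmorphN rmorph1.
by rewrite [LHS]rmorph_next_point IH.
Qed.

(** * Expansion in n at m = 1 *)

Definition eqmod (R : comNzRingType) (d u v : R) : Prop := exists t, u = v + d * t.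

(* For m = 1 the curve has good reduction at n = 0, every point of the sequence
   reduces to (1, 1, 1, 0), and w / z is a local parameter there. The coefficient
   c of n in w / z is additive for the group law up to the choice of the origin,
   whence an affine recursion c' = 2c - 1. *)
Definition first_order (R : comNzRingType) (n c K : R) (p : R * R * R * R) : Prop :=
  let: (x, y, z, w) := p in
  [/\ eqmod n x K, eqmod n y K, eqmod n z K & eqmod (n ^+ 2) w (c * K * n)].

(** Since [M] is -4K^5 modulo n, the point [o] contributes the factor 16K^10. In the last
    coordinate, modulo n^2, [o] gives 16K^10 n and the tangent vector 32(c - 1)K^10 n, in total (2c
    - 1) 16K^10 n. *)
Lemma first_order_next_point (R : comNzRingType) (n c K : R) p :
  first_order n c K p ->
  first_order n (2%:R * c - 1) (16%:R * K ^+ 10) (next_point 1 n p).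
Proof.
case: p => [[[x y] z] w] [[x' Ex] [y' Ey] [z' Ez] [w' Ew]].
(* [v] is the quotient of [w] by [n]. *)
pose v := c * K + n * w'.
rewrite /next_point /residual.
set p := (- x, y, z, w); set t := (_, 0, _, _); set o := (1, 1, 1, n).
have [e1] : eqmod n (diag_form (form1 1 n) t t) 0.
  exists (v * w * (4%:R * (1 - n ^+ 2) * z ^+ 2 - 2%:R * (1 - n ^+ 2) ^+ 2 * x ^+ 2)).
  by rewrite /t /v /= Ew; ring.
have [e2] : eqmod n (diag_form (form2 1 n) t t) (- (2%:R * K ^+ 4)).
  exists (4%:R * (1 + n ^+ 2) * z ^+ 2 * w * v
    - 2%:R * ((2%:R * n + n ^+ 3) * x ^+ 2 * z ^+ 2
              + (2%:R * K * x' + n * x' ^+ 2) * z ^+ 2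
              + K ^+ 2 * (2%:R * K * z' + n * z' ^+ 2))).
  by rewrite /t /v /= Ew Ex Ez; ring.
have [e3] : eqmod n (diag_form (form1 1 n) p o) (- (2%:R * K)).
  by exists (- x' + y' - 2%:R * z' + n * (x + y)); rewrite /= Ex Ey Ez; ring.
have [e4] : eqmod n (diag_form (form2 1 n) p o) (- (2%:R * K)).
  by exists (- x' - y' + n * (y - x) - 2%:R * w); rewrite /= Ex Ey; ring.
have [e5] : eqmod (n ^+ 2) (diag_form (form1 1 n) t o) (4%:R * c * K ^+ 2 * n).
  exists (2%:R * (2%:R * K * w' + v * (x' + z')) - 2%:R * w * (z + x)).
  by rewrite /v /= Ew Ex Ez; ring.
have [e6] : eqmod (n ^+ 2) (diag_form (form2 1 n) t o)
    (2%:R * (c + 1) * K ^+ 2 * n).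
  exists (2%:R * (K * (w' + x') + z' * (v + x)) + 2%:R * z * (w + n * x)).
  by rewrite /v /= Ew Ex Ez; ring.
move: (diag_form (form2 1 n) t o) (diag_form (form1 1 n) t o).
move: (diag_form (form2 1 n) p o) (diag_form (form1 1 n) p o).
move: (diag_form (form2 1 n) t t) (diag_form (form1 1 n) t t).
move=> qg qf bg bf cg cf Ecg Ecf Ebg Ebf Eqg Eqf.
have [N'] : eqmod (n ^+ 2) (cf * bg - cg * bf) (- (4%:R * (c - 1) * K ^+ 3 * n)).
  exists (e5 * bg + 4%:R * c * K ^+ 2 * e4 - e6 * bf - 2%:R * (c + 1) * K ^+ 2 * e3).
  by rewrite Ecf Ecg Ebg Ebf; ring.
have [M'] : eqmod n (qf * bg - qg * bf) (- (4%:R * K ^+ 5)).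
  by exists (e1 * bg - e2 * bf + 2%:R * K ^+ 4 * e3); rewrite Eqf Eqg Ebg Ebf; ring.
have [L'] : eqmod n (cg * qf - cf * qg) 0.
  exists ((2%:R * (c + 1) * K ^+ 2 + n * e6) * qf - (4%:R * c * K ^+ 2 + n * e5) * qg).
  by rewrite Ecf Ecg; ring.
move: (cf * bg - _) (qf * bg - _) (cg * qf - _) => N M L EL EM EN.
have [r'] : eqmod (n ^+ 2) (2%:R * N * L) 0.
  by exists (2%:R * (n * N' - 4%:R * (c - 1) * K ^+ 3) * L'); rewrite EN EL; ring.
have [s'] : eqmod (n ^+ 2) (- (2%:R * N * M)) (- (32%:R * (c - 1) * K ^+ 8 * n)).
  exists (- 2%:R * (N' * M - 4%:R * (c - 1) * K ^+ 3 * M')).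
  by rewrite EN EM; ring.
have [k'] : eqmod n (M ^+ 2) (16%:R * K ^+ 10).
  by exists (- (8%:R * K ^+ 5 * M') + n * M' ^+ 2); rewrite EM; ring.
move: (2%:R * N * L) (- (2%:R * N * M)) (M ^+ 2) => r s k Ek Es Er.
have Es1 : s = n * (- (32%:R * (c - 1) * K ^+ 8) + n * s') by rewrite Es; ring.
move: (- (32%:R * _ * _) + _) Es1 => s1 Es1.
have Er1 : r = n * (n * r') by rewrite Er; ring.
split.
- exists (- n * r' * x + s1 * (2%:R * z * w) + k').
  by rewrite Er1 Es1 Ek; ring.
- by exists (n * r' * y + k'); rewrite Er1 Ek; ring.
- exists (n * r' * z - s1 * ((1 ^+ 2 - n ^+ 2) * x * w) + k').
  by rewrite Er1 Es1 Ek; ring.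
- exists (r' * w - s' * ((1 + n ^+ 2) * x * z)
          + 32%:R * (c - 1) * K ^+ 8 * (n * x * z + (K * z' + x' * z)) + k').
  rewrite Er Es Ek Ex Ez; ring.
Qed.

(** The recursion doubles 1 - c, starting from c = -1. [K] is chosen before [n], so that [n] can
    vary later. *)
Lemma first_order_point_seq (k : nat) :
  exists2 K : int, K != 0 &
    forall n : int, first_order n (1 - 2%:R ^+ k.+1) K (point_seq 1 n k).
Proof.
elim: k => [|k [K K0 IH]].
  exists 1 => // n; rewrite /=; split; exists 0; ring.
exists (16%:R * K ^+ 10) => [|n]; first by rewrite mulf_neq0 ?expf_neq0.
have -> : 1 - 2%:R ^+ k.+2 = 2%:R * (1 - 2%:R ^+ k.+1) - 1 :> int.
  by rewrite [in LHS]exprS; ring.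
exact: first_order_next_point (IH n).
Qed.

(** * Solutions over Z[m, n] and their non-proportionality *)

Definition mn_point (k : nat) : quadruple := point_seq ('X_0 : Zmn) 'X_1 k.

Lemma eval_mn_point (m n : int) (k : nat) :
  map4 (evalmn m n) (mn_point k) = point_seq m n k.
Proof.
rewrite /evalmn /mn_point (rmorph_point_seq (meval (tnth [tuple m; n]))).
by congr point_seq; apply: mevalXU.
Qed.

Lemma toQmn_inj : injective toQmn.
Proof.
move=> p q /eqP; rewrite /toQmn tofrac_eq => /eqP E; apply/mpolyP => u.
by move/(congr1 (mcoeff u)): E; rewrite !mcoeff_map_mpoly; apply: intr_inj.
Qed.

Lemma toQmnM : {morph toQmn : p q / p * q}.
Proof. by move=> p q; rewrite /toQmn !rmorphM. Qed.

Lemma parametric_solution_mn_point (k : nat) : parametric_solution (mn_point k).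
Proof.
have ev m n := eval_mn_point m n k.
rewrite /parametric_solution; case: (mn_point k) ev => [[[x y] z] w] /= ev.
split=> [[x0 _ _ _]|m n _].
  (* At n = 0 the congruence modulo n is an equality, so [x] takes the value [K] at (1, 0). *)
  have [K K0 /(_ 0)] := first_order_point_seq k.
  rewrite -ev x0 /= => -[[t]]; rewrite /evalmn meval0 mul0r addr0 => E.
  by rewrite -E eqxx in K0.
have := on_curve_point_seq m n k; rewrite -ev /on_curve /= => -[].
move: (evalmn m n x) (evalmn m n y) (evalmn m n z) (evalmn m n w) => {ev}X Y Z W.
move=> /(congr1 (intr : int -> rat)) Hf /(congr1 (intr : int -> rat)) Hg.
have Ez : Z%:Q ^+ 2 = coef_a m n * X%:Q ^+ 2 + coef_b m n * Y%:Q ^+ 2.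
  rewrite /coef_a /coef_b; move: Hf.
  by rewrite !(rmorphD, rmorphB, rmorphN, rmorphXn, rmorphM, rmorph0, rmorph_nat) /= ; lra.
have Ew : W%:Q ^+ 2 = coef_b m n * X%:Q ^+ 2 - coef_a m n * Y%:Q ^+ 2.
  rewrite /coef_a /coef_b; move: Hg.
  by rewrite !(rmorphD, rmorphB, rmorphN, rmorphXn, rmorphM, rmorph0, rmorph_nat) /= ; lra.
(* What remains is the two-square identity in a, b, x^2, y^2. *)
rewrite -[4%N]/(2 * 2)%N !exprM Ez Ew; ring.
Qed.

(** Clearing denominators in the invariant w / z gives a relation in Z[m, n] that can be specialised
    at m = 1. *)
Lemma proportional_cross (x y z w x' y' z' w' : Zmn) :
  proportional (x, y, z, w) (x', y', z', w') -> w * z' = w' * z.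
Proof.
move=> [l [_ [_ _ Ez Ew]]]; apply: toQmn_inj.
by rewrite !toQmnM Ez Ew mulrCA mulrA.
Qed.

(** With n = |d| + 1, cancelling n makes d a multiple of an integer larger than |d|. *)
Lemma eq0_of_dvd_all (d : int) : (forall n : int, exists t, n * d = n ^+ 2 * t) -> d = 0.
Proof.
move=> H; have [t] := H (`|d| + 1)%R.
have n0 : `|d| + 1 != 0 :> int by rewrite lt0r_neq0 // ltr_wpDl.
rewrite expr2 -mulrA => /(mulfI n0) E.
apply/eqP; apply: contraT => d0.
have t0 : t != 0 by apply: contra_neq d0 => t0; rewrite E t0 mulr0.
have : `|d| + 1 <= `|d|.
  rewrite [leRHS](congr1 _ E) normrM ger0_norm ?addr_ge0 //.
  by rewrite ler_peMr ?addr_ge0 // -gtz0_ge1 normr_gt0.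
by rewrite gerDl.
Qed.

Lemma mn_point_nonproportional (i j : nat) :
  i <> j -> ~ proportional (mn_point i) (mn_point j).
Proof.
move=> ij Hp; apply: ij.
have [K K0 FK] := first_order_point_seq i.
have [K' K0' FK'] := first_order_point_seq j.
have evi n := eval_mn_point 1 n i; have evj n := eval_mn_point 1 n j.
case: (mn_point i) (mn_point j) Hp evi evj => [[[x y] z] w] [[[x' y'] z'] w'].
move=> /proportional_cross cross evi evj.
set c := 1 - 2%:R ^+ i.+1 in FK; set c' := 1 - 2%:R ^+ j.+1 in FK'.
(* Modulo n^2 the cross relation reads n(c - c')KK' = 0, for every n. *)
have : (c - c') * (K * K') = 0.
  apply: eq0_of_dvd_all => n.
  have : evalmn 1 n w * evalmn 1 n z' = evalmn 1 n w' * evalmn 1 n z.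
    by have := congr1 (evalmn 1 n) cross; rewrite /evalmn !mevalM.
  move: (FK n) (FK' n); rewrite -evi -evj /=.
  move=> [_ _ [z1 ->] [w1 ->]] [_ _ [z1' ->] [w1' ->]] E.
  exists (c' * K' * z1 + w1' * (K + n * z1) - c * K * z1' - w1 * (K' + n * z1')).
  move/eqP: E; rewrite -subr_eq0 => /eqP E0.
  rewrite -[RHS]addr0 -E0; ring.
move=> /eqP; rewrite !mulf_eq0 (negPf K0) (negPf K0') !orbF /c /c'.
rewrite subr_eq0 => /eqP /addrI /oppr_inj.
by move/(ieexprIn (isT : 0 < 2%:R :> int) isT) => [].
Qed.

Theorem theorem1 :
  exists s : nat -> quadruple,
    (forall i : nat, parametric_solution (s i)) /\
    (forall i j : nat, i <> j -> ~ proportional (s i) (s j)).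
Proof.
exists mn_point; split; first exact: parametric_solution_mn_point.
exact: mn_point_nonproportional.
Qed.
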